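(* Let $b\ge 2$ be an integer, let $D\subset\{0,1,\dots,b-1\}$ be a nonempty proper subset, let $S\subset\mathbb{N}$ be an infinite set, and let $$E_{S,D}=\Big\{\sum_{n=1}^\infty x_n b^{-n} : x_n\in D \text{ if } n\notin S, \text{ and } x_n\in\{0,1,\dots,b-1\} \text{ if } n\in S\Big\}\subset[0,1].$$ Then $E_{S,D}$ contains arbitrarily long arithmetic progressions if and only if the Assouad dimension of $E_{S,D}$ satisfies $\dim_A E_{S,D}=1$.
   Context: $\mathbb{N}=\{1,2,3,\dots\}$. Arithmetic progressions: for $k\ge 3$, a set $A\subset\mathbb{R}$ is a $k$-term arithmetic progression with gap $\delta>0$ if there exists $t>0$ such that $A=\{t+\delta x : x=0,1,\dots,k-1\}$. A set contains arbitrarily long arithmetic progressions if for every $k\ge 3$ it contains a $k$-term arithmetic progression (the gap may depend on $k$). Assouad dimension: let $X$ be a metric space (here $X=\mathbb{R}$) and $E\subset X$. For $r>0$ and a set $F$, let $N_r(F)$ be the least number of balls of radius $r$ needed to cover $F$, and for $r,R>0$ let $N_{r,R}(E)=\sup_{x\in E}N_r(B(x,R)\cap E)$. Then $$\dim_A E=\inf\Big\{\alpha\ge 0 : \text{there are constants } \rho, C>0 \text{ such that for all } 0<r<R<\rho,\ N_{r,R}(E)\le C\Big(\frac{R}{r}\Big)^{\alpha}\Big\}.$$ *)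

(* Defs.v *)
From HB Require Import structures.
From mathcomp Require Import all_boot all_order all_algebra.
From mathcomp Require Import all_classical all_reals all_analysis.
Set Implicit Arguments.
Unset Strict Implicit.
Unset Printing Implicit Defensive.
Import Order.TTheory GRing.Theory Num.Theory.
Import numFieldNormedType.Exports.
Local Open Scope classical_set_scope.
Local Open Scope ring_scope.

Definition is_AP (R : realType) (k : nat) (delta : R) (A : set R) : Prop :=
  0 < delta /\
  exists t : R, 0 < t /\ A = [set t + delta * x%:R | x in [set x : nat | (x < k)%N]].

Definition contains_arbitrarily_long_APs (R : realType) (E : set R) : Prop :=
  forall k : nat, (3 <= k)%N ->
    exists (A : set R) (delta : R), A `<=` E /\ is_AP k delta A.

(* The least number of (open) [r]-balls, with centres anywhere in [X], needed to
   cover [F]; it is [+oo] when no finite cover exists. *)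
Definition covering_number (R : realType) (X : metricType R) (r : R)
    (F : set X) : \bar R :=
  ereal_inf [set (size s)%:R%:E |
    s in [set s : seq X | F `<=` \bigcup_(c in [set` s]) ball c r]].

Definition local_covering_number (R : realType) (X : metricType R) (r r' : R)
    (E : set X) : \bar R :=
  ereal_sup [set covering_number r (ball x r' `&` E) | x in E].

Definition assouad_dim (R : realType) (X : metricType R) (E : set X) : \bar R :=
  ereal_inf [set alpha%:E | alpha in [set alpha : R | 0 <= alpha /\
    exists rho C : R, 0 < rho /\ 0 < C /\
      forall r r' : R, 0 < r -> r < r' -> r' < rho ->
        (local_covering_number r r' E <= (C * (r' / r) `^ alpha)%:E)%E]].

(* Digits are indexed from 1: the value [x 0] is unconstrained and unused. *)
Definition digit_set (R : realType) (b : nat) (S : set nat) (D : {set 'I_b}) :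
    set R :=
  [set \big[+%R/0]_(1 <= n <oo) ((x n)%:R * b%:R ^- n : R) |
    x in [set x : nat -> 'I_b | forall n, (1 <= n)%N -> ~ S n -> x n \in D]].
Arguments digit_set R {b} S D.

(* Main.v *)
Require Import Defs.
From HB Require Import structures.
From mathcomp Require Import all_boot all_order all_algebra.
From mathcomp Require Import all_classical all_reals all_analysis.
From mathcomp Require Import zify ring lra.
Import Order.TTheory GRing.Theory Num.Theory.
Import numFieldNormedType.Exports.
Local Open Scope classical_set_scope.
Local Open Scope ring_scope.

(** The digit set has long arithmetic progressions, or full Assouad dimension,
    for one and the same reason: the set S of free positions contains
    arbitrarily long blocks of consecutive integers.  Both equivalences are
    proved separately and composed.

    If the positions n + 1, ..., n + L are all free, fixing every other digit
    leaves b^L points of the set, which are equally spaced with gap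
    b^-(n + L) ([run_progression]).  These are the required progressions.  They
    also force about b^L balls of radius b^-(n + L) inside a ball of radius
    b^-n, and n can be taken as large as desired, so no exponent below 1 works
    in the definition of the dimension ([long_runs_dim_ge1]); exponent 1 always
    works for subsets of the line ([assouad_dim_line_le1]).

    Otherwise there is an L such that every window of L consecutive positions
    contains a position j outside S, at which some digit d is forbidden.  The
    open b-adic intervals of level j whose last digit is d are then disjoint
    from the set ([digit_set_avoids_gap]).  These holes recur with period
    b^(1 - j), and choosing j so that b^-j exceeds the gap of a progression,
    but by a bounded factor only, traps the progression between two successive
    holes, which bounds its length ([progression_length_le]).  Moreover at
    least one of the q = b^L subintervals of each b-adic interval is lost
    whenever L digits are read, so (q - 1)^m subintervals suffice m * L levels
    further down ([descendant_cells]), and the dimension is at most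
    ln (q - 1) / ln q < 1 ([bounded_runs_dim_lt1]). *)

(** * Base-b expansions and their finite prefixes *)

(** The index of a closed b-adic interval of level [n] containing the expansion
    of [x].  It depends on the digits and not only on the value, so that the end
    points, which have two expansions, need no convention. *)
Fixpoint prefix {b : nat} (x : nat -> 'I_b) (n : nat) : nat :=
  if n is m.+1 then (prefix x m * b + x m.+1)%N else 0%N.

Definition expansion (R : realType) {b : nat} (x : nat -> 'I_b) : R :=
  \big[+%R/0]_(1 <= n <oo) ((x n)%:R * b%:R ^- n : R).

Definition has_long_runs (S : set nat) : Prop :=
  forall L : nat, exists n : nat, forall j : nat, (n < j <= n + L)%N -> S j.

Lemma mulX_expN_add {F : fieldType} (x : F) (n m : nat) :
  x != 0 -> x ^+ m * x ^- (n + m) = x ^- n.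
Proof. by move=> x0; rewrite exprD invfM mulrCA mulfV ?mulr1 // expf_neq0. Qed.

Lemma geometric_below {R : realType} (b : nat) (e : R) :
  (2 <= b)%N -> 0 < e -> exists n : nat, b%:R ^- n < e.
Proof.
move=> hb e0; have b0 : 0 < b%:R :> R by rewrite ltr0n; lia.
exists (Num.truncn e^-1).+1; rewrite invf_plt ?posrE ?exprn_gt0 //.
apply: (lt_trans (y := (Num.truncn e^-1).+1%:R)).
  have e'0 : 0 <= e^-1 by rewrite invr_ge0 ltW.
  by have /andP[] := truncn_itv e'0.
by rewrite -natrX ltr_nat ltn_expl.
Qed.

Lemma partial_expansionE {R : realType} {b : nat} (x : nat -> 'I_b) (n : nat) :
  (0 < b)%N ->
  \sum_(1 <= i < n.+1) ((x i)%:R * b%:R ^- i) = (prefix x n)%:R * b%:R ^- n :> R.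
Proof.
move=> b0; have b0R : b%:R != 0 :> R by rewrite pnatr_eq0 -lt0n.
elim: n => [|n IHn]; first by rewrite big_geq //= mul0r.
rewrite big_nat_recr //= IHn natrD natrM mulrDl; congr (_ + _).
by rewrite exprS invfM mulrA mulfK.
Qed.

(** The lower and the upper end points of the b-adic intervals given by the
    prefixes are monotone in opposite directions, so the value of the expansion
    exists and lies between them. *)
Lemma lower_approx_mono {R : realType} {b : nat} (x : nat -> 'I_b) :
  {homo (fun n => (prefix x n)%:R * b%:R ^- n : R) : n m / (n <= m)%N >-> n <= m}.
Proof.
have b0 : (0 < b)%N by apply: leq_ltn_trans (ltn_ord (x 0%N)).
apply/nondecreasing_seqP => n.
rewrite -!partial_expansionE // [leRHS]big_nat_recr //= lerDl.
by rewrite mulr_ge0 // invr_ge0 exprn_ge0.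
Qed.

Lemma upper_approx_mono {R : realType} {b : nat} (x : nat -> 'I_b) :
  {homo (fun n => (prefix x n).+1%:R * b%:R ^- n : R) :
    n m / (n <= m)%N >-> m <= n}.
Proof.
have b0 : (0 < b)%N by apply: leq_ltn_trans (ltn_ord (x 0%N)).
have b0R : b%:R != 0 :> R by rewrite pnatr_eq0 -lt0n.
apply/nonincreasing_seqP => n /=.
rewrite exprS invfM mulrA ler_wpM2r ?invr_ge0 ?exprn_ge0 //.
rewrite ler_pdivrMr ?ltr0n // -natrM ler_nat.
by have := ltn_ord (x n.+1); nia.
Qed.

Lemma approx_cvg {R : realType} {b : nat} (x : nat -> 'I_b) :
  (prefix x n)%:R * b%:R ^- n @[n --> \oo] --> expansion R x.
Proof.
have b0 : (0 < b)%N by apply: leq_ltn_trans (ltn_ord (x 0%N)).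
have cv : cvgn (fun n => (prefix x n)%:R * b%:R ^- n : R).
  apply: nondecreasing_is_cvgn; first exact: lower_approx_mono.
  exists 1 => _ [n _ <-]; have := upper_approx_mono (R := R) x 0 n (leq0n n).
  rewrite /= expr0 invr1 mulr1; apply: le_trans.
  by rewrite ler_wpM2r ?invr_ge0 ?exprn_ge0 // ler_nat.
have e : (fun n => \sum_(1 <= i < n.+1) ((x i)%:R * b%:R ^- i) : R) =
         (fun n => (prefix x n)%:R * b%:R ^- n).
  by apply/funext => n; rewrite partial_expansionE.
rewrite -e in cv *.
move/cvg_ex: cv => [l cl].
have cl' : (\sum_(1 <= i < n) ((x i)%:R * b%:R ^- i) : R) @[n --> \oo] --> l.
  by rewrite -cvg_shiftS.
rewrite /expansion (cvg_lim _ cl') //.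
Qed.

Lemma expansion_ge {R : realType} {b : nat} (x : nat -> 'I_b) (n : nat) :
  (prefix x n)%:R * b%:R ^- n <= expansion R x.
Proof.
rewrite -(cvg_lim _ (approx_cvg x)) //.
apply: nondecreasing_cvgn_le; first exact: lower_approx_mono.
by apply/cvg_ex; exists (expansion R x); exact: approx_cvg.
Qed.

Lemma expansion_le {R : realType} {b : nat} (x : nat -> 'I_b) (n : nat) :
  expansion R x <= (prefix x n).+1%:R * b%:R ^- n.
Proof.
rewrite -(cvg_lim _ (approx_cvg x)) //.
apply: limr_le; first by apply/cvg_ex; exists (expansion R x); exact: approx_cvg.
near=> m; apply: le_trans (upper_approx_mono x n m _).
  by rewrite ler_wpM2r ?invr_ge0 ?exprn_ge0 // ler_nat.
by near: m; exists n.
Unshelve. all: by end_near. Qed.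

Lemma prefix_div {b : nat} (x : nat -> 'I_b) (n l : nat) :
  (prefix x (n + l) %/ b ^ l)%N = prefix x n.
Proof.
have b0 : (0 < b)%N by apply: leq_ltn_trans (ltn_ord (x 0%N)).
elim: l => [|l IHl]; first by rewrite addn0 divn1.
by rewrite addnS /= expnS divnMA divnMDl // (divn_small (ltn_ord _)) addn0.
Qed.

Lemma prefix_mod {b : nat} (x : nat -> 'I_b) (n : nat) :
  (0 < n)%N -> (prefix x n %% b)%N = x n.
Proof. by case: n => // n _; rewrite /= modnMDl modn_small. Qed.

(** * Long runs of free positions give long progressions *)

(** A run of length [N + L] has a subrun of length [L] starting beyond [N].  This
    is what makes the progressions available at arbitrarily small scales. *)
Lemma long_runs_beyond (S : set nat) (L N : nat) :
  has_long_runs S ->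
  exists2 n, (N <= n)%N & forall j, (n < j <= n + L)%N -> S j.
Proof.
move=> /(_ (N + L)%N)[n hn]; exists (n + N)%N; first exact: leq_addl.
by move=> j /andP[nj jL]; apply: hn; rewrite addnA jL andbT; lia.
Qed.

(** Writing the base-b digits of [i] in the positions of a run amounts to
    appending [i] to the prefix; the intermediate stages [l] carry the
    induction, since they read off the leading digits of [i]. *)
Lemma prefix_run {b : nat} (x : nat -> 'I_b) (n L i l : nat) :
  (i < b ^ L)%N ->
  (forall j, (n < j <= n + L)%N -> (x j = i %/ b ^ (n + L - j) %% b :> nat)%N) ->
  (l <= L)%N -> (prefix x (n + l) = prefix x n * b ^ l + i %/ b ^ (L - l))%N.
Proof.
move=> iL xE; elim: l => [|l IHl] lL.
  by rewrite addn0 subn0 expn0 muln1 divn_small ?addn0.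
rewrite addnS /= (IHl (ltnW lL)) xE; last by lia.
have -> : (n + L - (n + l).+1 = L - l.+1)%N by lia.
have -> : (L - l = (L - l.+1).+1)%N by lia.
rewrite expnSr divnMA [in RHS](divn_eq (i %/ b ^ (L - l.+1)) b) expnSr; ring.
Qed.

(** The points that agree outside a run with one fixed admissible sequence [x 0]:
    changing the digits of the run to those of [i] adds [i * b ^ m] to each
    prefix of length [n + L + m], hence [i * b^-(n + L)] to the value. *)
Lemma run_progression {R : realType} {b : nat} (D : {set 'I_b}) (S : set nat)
  (n L : nat) :
  D != finset.set0 -> (forall j, (n < j <= n + L)%N -> S j) ->
  exists2 t : R, 0 <= t & forall i : nat, (i < b ^ L)%N ->
    digit_set R S D (t + i%:R * b%:R ^- (n + L)).
Proof.
move=> /finset.set0Pn[d dD] run.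
have b0 : (0 < b)%N by apply: leq_ltn_trans (ltn_ord d).
have b0R : b%:R != 0 :> R by rewrite pnatr_eq0 -lt0n.
pose x i j : 'I_b := if (n < j <= n + L)%N then
  Ordinal (ltn_pmod (i %/ b ^ (n + L - j)) b0) else d.
have prefn i : prefix (x i) n = prefix (x 0%N) n.
  suff H m : (m <= n)%N -> prefix (x i) m = prefix (x 0%N) m by exact: H.
  elim: m => // m IHm mn /=; rewrite IHm; last exact: ltnW.
  by rewrite /x ltnNge mn.
have prefL i : (i < b ^ L)%N ->
    (prefix (x i) (n + L) = prefix (x 0%N) n * b ^ L + i)%N.
  move=> iL; rewrite (prefix_run (x i) n L i L iL) // ?subnn ?divn1 ?prefn //.
  by move=> j jn; rewrite /x jn.
have pref i m : (i < b ^ L)%N ->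
    (prefix (x i) (n + L + m) = prefix (x 0%N) (n + L + m) + i * b ^ m)%N.
  move=> iL; elim: m => [|m IHm].
    by rewrite addn0 expn0 muln1 !prefL ?addn0 ?expn_gt0 ?b0.
  rewrite addnS /= IHm expnSr.
  have -> : x i (n + L + m).+1 = x 0%N (n + L + m).+1.
    by rewrite /x (_ : (_ < _ <= _)%N = false) //; lia.
  by ring.
exists (expansion R (x 0%N)).
  by have := expansion_ge (R := R) (x 0%N) 0; rewrite /= mul0r.
move=> i iL; exists (x i).
  move=> j _ nSj; rewrite /x; case: ifPn => // jn.
  by have := nSj (run j jn).
rewrite -/(expansion R (x i)).
rewrite -[LHS](cvg_lim _ (approx_cvg (x i))) //.
apply: (cvg_lim (@Rhausdorff R)).
rewrite -(cvg_shiftn (n + L)) /=.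
have -> : (fun m => (prefix (x i) (m + (n + L)))%:R * b%:R ^- (m + (n + L)) : R) =
  (fun m => (prefix (x 0%N) (m + (n + L)))%:R * b%:R ^- (m + (n + L)) +
            i%:R * b%:R ^- (n + L)).
  apply/funext => m; rewrite [(m + _)%N]addnC pref // natrD natrM natrX mulrDl.
  congr (_ + _); rewrite -mulrA; congr (_ * _).
  by rewrite [in LHS]exprD invfM mulrCA mulfV ?mulr1 // expf_neq0.
apply: cvgD; last exact: cvg_cst.
have := approx_cvg (R := R) (x 0%N).
by rewrite -(cvg_shiftn (n + L)).
Qed.

Lemma long_runs_AP {R : realType} {b : nat} (D : {set 'I_b}) (S : set nat) :
  (2 <= b)%N -> D != finset.set0 -> has_long_runs S ->
  contains_arbitrarily_long_APs (digit_set R S D).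
Proof.
move=> hb hD runs k _; have [n hn] := runs k.
have [t t0 ht] := run_progression (R := R) D S n k hD hn.
(* The run has length k because b ^ k > k.  The progression starts at its second
   point, which makes the initial term positive. *)
set h := b%:R ^- (n + k) in ht.
have h0 : 0 < h by rewrite invr_gt0 exprn_gt0 // ltr0n; lia.
exists [set (t + h) + h * m%:R | m in [set m : nat | (m < k)%N]], h; split.
  move=> _ [m mk <-]; have -> : t + h + h * m%:R = t + m.+1%:R * h.
    by rewrite -[m.+1]addn1 natrD; ring.
  by apply: ht; apply: leq_ltn_trans mk _; exact: ltn_expl.
by split => //; exists (t + h); split => //; rewrite ltr_wpDl.
Qed.

(** * Bounded runs exclude long progressions *)

Lemma bounded_runs (S : set nat) : ~ has_long_runs S ->
  exists L : nat, forall n, exists2 j, (n < j <= n + L)%N & ~ S j.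
Proof.
move=> /existsNP[L hL]; exists L => n.
have /existsNP[j /not_implyP[jn nSj]] := (forallNP _).2 hL n.
by exists j.
Qed.

(** Only points interior to a b-adic interval determine their j-th digit: an end
    point may have a second expansion, whose j-th digit is allowed.  For an
    interior point every expansion has prefix [K], so its j-th digit is [d]. *)
Lemma digit_set_avoids_gap {R : realType} {b : nat} (D : {set 'I_b}) (S : set nat)
  (j K : nat) (d : 'I_b) (y : R) :
  (0 < j)%N -> ~ S j -> d \notin D -> (K %% b = d)%N -> digit_set R S D y ->
  ~~ (K%:R * b%:R ^- j < y < K.+1%:R * b%:R ^- j).
Proof.
move=> j0 nSj dD Kd [x xD <-]; rewrite -/(expansion R x).
have b0 : (0 < b)%N by apply: leq_ltn_trans (ltn_ord d).
have v0 : 0 < b%:R ^- j :> R by rewrite invr_gt0 exprn_gt0 // ltr0n.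
apply/negP => /andP[lo hi].
have := le_lt_trans (expansion_ge x j) hi.
rewrite ltr_pM2r // ltr_nat ltnS => pK.
have := lt_le_trans lo (expansion_le x j).
rewrite ltr_pM2r // ltr_nat ltnS => Kp.
have E : K = prefix x j by apply/eqP; rewrite eqn_leq Kp pK.
have Ed : d = x j by apply/val_inj; rewrite /= -prefix_mod // -E Kd.
by move: dD; rewrite Ed xD.
Qed.

(** A progression whose gap is smaller than a hole cannot jump over it, and the
    next hole to the right of any point is at distance at most 2b holes. *)
Lemma progression_length_le {R : realType} {b : nat} (D : {set 'I_b})
  (S : set nat) (L : nat) (t delta : R) (k : nat) :
  (2 <= b)%N -> D \proper [set: 'I_b]%SET ->
  (forall n, exists2 j, (n < j <= n + L)%N & ~ S j) ->
  0 < delta -> (forall i, (i <= k)%N -> digit_set R S D (t + delta * i%:R)) ->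
  (k <= 2 * b ^ L.+1)%N.
Proof.
move=> hb /fintype.properP[_ [d _ dD]] hL dl hE.
have b0 : 0 < b%:R :> R by rewrite ltr0n; lia.
have pw n : 0 < b%:R ^- n :> R by rewrite invr_gt0 exprn_gt0.
have pwM n m : b%:R ^+ m * b%:R ^- (n + m) = b%:R ^- n :> R.
  by rewrite mulX_expN_add // gt_eqF.
have pwS n m : (n <= m)%N -> b%:R ^- m <= b%:R ^- n :> R.
  move=> nm; rewrite lef_pV2 ?posrE ?exprn_gt0 // ler_weXn2l //.
  by rewrite ler1n; lia.
suff H : k%:R * delta <= (2 * b ^ L.+1)%:R * delta.
  by move: H; rewrite ler_pM2r // ler_nat.
have [M0 hM0] := geometric_below b delta hb dl.
have exM : exists n, b%:R ^- n <= delta by exists M0; exact: ltW.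
(* M is the first level not coarser than the gap. *)
case: (ex_minnP exM) => M hM minM.
(* A gap of at least b^-L: the progression is short because it lies in [0, 1]. *)
have [ML|LM] := leqP M L.
  have k1 : k%:R * delta <= 1.
    have [x _ xe] := hE 0%N (leq0n _); have [y _ ye] := hE k (leqnn k).
    have := expansion_ge (R := R) x 0; have := expansion_le (R := R) y 0.
    rewrite /expansion xe ye /= expr0 invr1 !mulr1 mulr0 addr0 => h1 h2.
    by rewrite mulrC; lra.
  apply: (le_trans k1).
  have : (b ^ L)%:R * b%:R ^- L <= (2 * b ^ L.+1)%:R * delta :> R.
    apply: ler_pM; first exact: ler0n.
    - exact: ltW.
    - by rewrite ler_nat expnS; nia.
    - exact: le_trans (pwS _ _ ML) hM.
  by rewrite natrX mulfV // expf_neq0 // gt_eqF.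
(* The window ends at M - 1, the last level still coarser than the gap, so holes
   of level j are larger than the gap but at most b ^ L times larger. *)
have [j /andP[jn jL] nSj] := hL (M.-1 - L)%N.
have dj : delta < b%:R ^- j.
  rewrite ltNge; apply/negP => /minM; lia.
have jd : b%:R ^- j <= b%:R ^+ L * delta.
  apply: le_trans (_ : b%:R ^+ L * b%:R ^- M <= _); last first.
    by rewrite ler_wpM2l // exprn_ge0 // ltW.
  have -> : M = (M - L + L)%N by lia.
  by rewrite pwM; apply: pwS; lia.
have [x _ xe] := hE 0%N (leq0n _); rewrite mulr0 addr0 in xe.
(* The first hole in the next block of b intervals of level j after t. *)
set K := ((prefix x j %/ b).+1 * b + d)%N.
have Kd : (K %% b = d)%N by rewrite /K modnMDl modn_small.
have K1 : ((prefix x j).+1 <= K)%N.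
  have := ltn_pmod (prefix x j) (d := b).
  by rewrite /K mulSn {2}(divn_eq (prefix x j) b); lia.
have K2 : (K <= prefix x j + 2 * b)%N.
  by rewrite /K mulSn; have := leq_divM (prefix x j) b; have := ltn_ord d; lia.
have below i : (i <= k)%N -> t + delta * i%:R <= K%:R * b%:R ^- j.
  elim: i => [|i IHi] ik.
    rewrite mulr0 addr0 -xe; apply: (le_trans (expansion_le x j)).
    by rewrite ler_pM2r // ler_nat.
  have := digit_set_avoids_gap (R := R) D S j K d _ _ nSj dD Kd (hE _ ik).
  rewrite negb_and -!leNgt => /(_ (leq_ltn_trans (leq0n _) jn)) /orP[//|].
  have := IHi (ltnW ik); rewrite -[i.+1]addn1 -[K.+1]addn1 !natrD.
  by rewrite mulrDl mulrDr; lra.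
have := below k (leqnn k).
have := expansion_ge (R := R) x j; rewrite /expansion xe => tlo khi.
have : k%:R * delta <= (2 * b)%:R * b%:R ^- j.
  have : K%:R * b%:R ^- j <= (prefix x j + 2 * b)%:R * b%:R ^- j :> R.
    by rewrite ler_pM2r // ler_nat.
  by rewrite natrD mulrDl [k%:R * _]mulrC; lra.
move/le_trans; apply.
rewrite expnS mulnA [(2 * b * b ^ L)%:R]natrM natrX -mulrA ler_wpM2l //.
Qed.

Lemma AP_long_runs {R : realType} {b : nat} (D : {set 'I_b}) (S : set nat) :
  (2 <= b)%N -> D \proper [set: 'I_b]%SET ->
  contains_arbitrarily_long_APs (digit_set R S D) -> has_long_runs S.
Proof.
move=> hb hD hAP; apply: contrapT => /bounded_runs[L hL].
have [|A [delta [AE [d0 [t [_ At]]]]]] := hAP (2 * b ^ L.+1 + 3)%N; first lia.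
have : (2 * b ^ L.+1 + 2 <= 2 * b ^ L.+1)%N.
  apply: (progression_length_le D S L t delta) => // i ik.
  by apply: AE; rewrite At; exists i => //=; lia.
lia.
Qed.

(** * Covering numbers and the dimension when runs are long *)

Lemma covering_number_le {R : realType} (r : R) (F : set R^o) (s : seq R) :
  (forall y, F y -> exists2 c, c \in s & `|c - y| < r) ->
  (@covering_number R R^o r F <= (size s)%:R%:E)%E.
Proof.
by move=> cov; apply: ereal_inf_lbound; exists s.
Qed.

(** An open ball of radius [r] contains at most one of a family of points that
    are pairwise at distance at least [2 * r]. *)
Lemma covering_number_ge {R : realType} (r : R) (F : set R^o) (N : nat)
  (p : nat -> R) :
  (forall i, (i < N)%N -> F (p i)) ->
  (forall i j, (i < j < N)%N -> 2 * r <= `|p i - p j|) ->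
  (N%:R%:E <= @covering_number R R^o r F)%E.
Proof.
move=> pF psep; apply: le_ereal_inf_tmp => _ [s /= cov <-].
rewrite lee_fin ler_nat.
have H i : exists c : R, (i < N)%N -> c \in s /\ `|c - p i| < r.
  have [iN|_] := ltnP i N; last by exists 0.
  have [c cs] := cov _ (pF i iN); rewrite -ball_normE /= => cr.
  by exists c.
have [c hc] := choice H.
have sep i j : (i < j < N)%N -> c i != c j.
  move=> ijN; apply/eqP => cij.
  have /hc[_ ci] : (i < N)%N by lia.
  have /hc[_ cj] : (j < N)%N by lia.
  have := psep i j ijN; apply/negP; rewrite -ltNge.
  rewrite cij in ci.
  have := ler_distD (c j) (p i) (p j); rewrite [`|p i - c j|]distrC.
  by lra.
rewrite -(size_iota 0 N) -(size_map c); apply: uniq_leq_size.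
  rewrite map_inj_in_uniq ?iota_uniq // => i j.
  rewrite !mem_iota !add0n /= => iN jN cij.
  have [ij|ji|//] := ltngtP i j.
    by have := sep i j; rewrite ij jN cij eqxx => /(_ isT).
  by have := sep j i; rewrite ji iN cij eqxx => /(_ isT).
move=> x /mapP[i]; rewrite mem_iota add0n /= => iN ->.
by have [] := hc i iN.
Qed.

(** An interval of length [2 * r'] is covered by about [2 * r' / r] balls centred
    at the points of an arithmetic progression with gap [r]. *)
Lemma assouad_dim_line_le1 {R : realType} (E : set R^o) :
  (@assouad_dim R R^o E <= 1)%E.
Proof.
apply: ereal_inf_lbound; exists 1 => //=; split => //.
exists 1, 3; do 2![split => //]; move=> r r' r0 rr' _.
apply: ge_ereal_sup => _ [x Ex <-].
have r'0 : 0 < r' by apply: lt_trans rr'.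
rewrite powRr1; last by rewrite divr_ge0 // ltW.
(* The constant 3: there are at most 2 * r' / r + 1 centres, and 1 <= r' / r. *)
set N := Num.truncn (2 * r' / r).
have q0 : 0 <= 2 * r' / r by rewrite divr_ge0 ?mulr_ge0 // ltW.
pose s := [seq x - r' + i%:R * r | i <- iota 0 N.+1].
apply: (@le_trans _ _ ((size s)%:R%:E)); last first.
  rewrite lee_fin size_map size_iota -addn1 natrD.
  have : N%:R <= 2 * r' / r by rewrite truncn_le.
  have : 1 <= r' / r by rewrite ler_pdivlMr // mul1r ltW.
  by rewrite -[2 * r' / r]mulrA; lra.
apply: covering_number_le => y [] /= + _; rewrite -ball_normE /= => xy.
have z0 : 0 <= (y - (x - r')) / r.
  by rewrite divr_ge0 ?ltW //; move: xy; rewrite ltr_norml; lra.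
exists (x - r' + (Num.truncn ((y - (x - r')) / r))%:R * r).
  apply/mapP; exists (Num.truncn ((y - (x - r')) / r)) => //.
  rewrite mem_iota add0n ltnS /=; apply: le_truncn.
  rewrite ler_pM2r ?invr_gt0 //.
  by move: xy; rewrite ltr_norml; lra.
have /andP[] := truncn_itv z0.
rewrite ler_pdivlMr // ltr_pdivrMr // -natr1 mulrDl.
by move=> h1 h2; rewrite ltr_norml; lra.
Qed.

(** For an exponent [alpha < 1], the b^L separated points found at arbitrarily
    small scales bound (b^L)^(1 - alpha) by a constant independent of [L]. *)
Lemma long_runs_dim_ge1 {R : realType} {b : nat} (D : {set 'I_b}) (S : set nat) :
  (2 <= b)%N -> D != finset.set0 -> has_long_runs S ->
  (1 <= @assouad_dim R R^o (digit_set R S D))%E.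
Proof.
move=> hb hD runs; apply: le_ereal_inf_tmp => _ [alpha /= [a0 H] <-].
have [rho [C [rho0 [C0 {}H]]]] := H.
rewrite lee_fin leNgt; apply/negP => a1.
have b0 : 0 < b%:R :> R by rewrite ltr0n; lia.
have key L : (b%:R ^+ L) `^ (1 - alpha) <= C * 4 `^ alpha.
  have [N hN] := geometric_below b (rho / 2) hb (divr_gt0 rho0 (ltr0Sn _ 1)).
  have [n Nn hn] := long_runs_beyond S L N runs.
  have [t _ ht] := run_progression (R := R) D S n L hD hn.
  set h : R := b%:R ^- (n + L) in ht.
  have h0 : 0 < h by rewrite invr_gt0 exprn_gt0.
  have B1 : 1 <= b%:R ^+ L :> R by rewrite exprn_ege1 // ler1n; lia.
  have hL : b%:R ^+ L * h = b%:R ^- n.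
    by rewrite /h mulX_expN_add // gt_eqF.
  have nN : b%:R ^- n <= b%:R ^- N :> R.
    by rewrite lef_pV2 ?posrE ?exprn_gt0 // ler_weXn2l // ler1n; lia.
  (* Balls of radius h / 2 separate the points t + i h, i < b ^ L, and a ball of
     radius 2 b^-n about t contains them all. *)
  pose r := h / 2; pose r' := 2 * b%:R ^- n : R.
  have r0 : 0 < r by rewrite /r divr_gt0.
  have rr : r' / r = 4 * b%:R ^+ L by rewrite /r' /r -hL; field; rewrite gt_eqF.
  have rr' : r < r' by rewrite -[r]mul1r -ltr_pdivlMr // rr; lra.
  have r'rho : r' < rho by rewrite /r'; lra.
  have := H r r' r0 rr' r'rho; rewrite rr => Hrr.
  have : ((b ^ L)%:R%:E <= (C * (4 * b%:R ^+ L) `^ alpha)%:E)%E.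
    apply: le_trans Hrr.
    have Et : digit_set R S D t.
      by have := ht 0%N; rewrite mul0r addr0 expn_gt0; apply; lia.
    apply: (@le_trans _ _ (@covering_number R R^o r
      (ball (t : R^o) r' `&` digit_set R S D))).
      apply: (covering_number_ge _ _ _ (fun i => t + i%:R * h)).
        move=> i iL; split; last exact: ht.
        rewrite -ball_normE /= opprD addrA subrr add0r normrN.
        rewrite ger0_norm ?mulr_ge0 // ?ltW //.
        have : i%:R * h <= b%:R ^+ L * h.
          by rewrite ler_pM2r // -natrX ler_nat ltnW.
        have : 0 < b%:R ^- n :> R by rewrite invr_gt0 exprn_gt0.
        by rewrite hL /r'; lra.
      move=> i j /andP[ij _].
      have -> : t + i%:R * h - (t + j%:R * h) = - ((j - i)%:R * h).
        by rewrite natrB ?(ltnW ij) //; ring.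
      rewrite normrN ger0_norm ?mulr_ge0 ?(ltW h0) // /r.
      have : 1%:R * h <= (j - i)%:R * h by rewrite ler_pM2r // ler_nat subn_gt0.
      by lra.
    by apply: ereal_sup_ubound; exists t.
  have Bp : 0 < b%:R ^+ L :> R by rewrite exprn_gt0.
  rewrite lee_fin natrX powRM ?(ltW Bp) // => HB.
  rewrite powRD; last by rewrite (gt_eqF Bp) implybT.
  rewrite powRr1 ?(ltW Bp) // powRN ler_pdivrMr ?powR_gt0 // -mulrA //.
set Q := C * 4 `^ alpha in key.
have Q0 : 0 < Q by rewrite mulr_gt0 // powR_gt0.
have a1' : 0 < 1 - alpha by rewrite subr_gt0.
have Y0 : 0 < (Q `^ (1 - alpha)^-1)^-1 by rewrite invr_gt0 powR_gt0.
have [L hL] := geometric_below b _ hb Y0.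
have := key L; rewrite leNgt => /negP; apply.
have -> : Q = (Q `^ (1 - alpha)^-1) `^ (1 - alpha).
  by rewrite -powRrM mulVf ?gt_eqF // powRr1 // ltW.
apply: gt0_ltr_powR => //; rewrite ?nnegrE ?powR_ge0 ?exprn_ge0 // ?ltW //.
by move: hL; rewrite ltf_pV2 // posrE ?exprn_gt0 ?powR_gt0.
Qed.

(** * Bounded runs make the dimension smaller than 1 *)

(** Of the [b ^ L] ways to extend a prefix by [L] digits at least one is excluded
    each time: a digit of the window lies outside [S] and cannot be [d]. *)
Lemma descendant_cells {b : nat} (D : {set 'I_b}) (S : set nat) (L n m K : nat) :
  D \proper [set: 'I_b]%SET ->
  (forall n, exists2 j, (n < j <= n + L)%N & ~ S j) ->
  exists2 s : seq nat, (size s <= (b ^ L).-1 ^ m)%N &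
    forall x : nat -> 'I_b, (forall j, (1 <= j)%N -> ~ S j -> x j \in D) ->
      prefix x n = K -> prefix x (n + m * L) \in s.
Proof.
move=> /fintype.properP[_ [d _ dD]] hL.
have b0 : (0 < b)%N by apply: leq_ltn_trans (ltn_ord d).
elim: m => [|m [s ss hs]].
  by exists [:: K] => // x _ <-; rewrite addn0 inE.
set N := (n + m * L)%N in hs.
have [j /andP[jN jL] nSj] := hL N.
(* The excluded extension e has d in position j and zeros elsewhere. *)
set c := (N + L - j)%N; pose e := (d * b ^ c)%N.
have eq : (e < b ^ L)%N.
  apply: (@leq_trans (b ^ c.+1)).
    by rewrite expnS ltn_pmul2r ?expn_gt0 ?b0.
  by apply: leq_pexp2l => //; rewrite /c; lia.
exists [seq (k * b ^ L + i)%N | k <- s, i <- rem e (iota 0 (b ^ L))].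
  rewrite size_allpairs size_rem ?size_iota ?mem_iota // expnSr.
  by rewrite leq_mul2r ss orbT.
move=> x xD xK; apply/allpairsP.
exists (prefix x N, (prefix x (N + L) %% b ^ L)%N) => /=; split.
- exact: hs.
- rewrite mem_rem_uniq ?iota_uniq // inE mem_iota /= ltn_pmod ?expn_gt0 ?b0 //.
  rewrite andbT; apply/negP => /eqP xe.
  have pe : prefix x (N + L) = (prefix x N * b ^ L + e)%N.
    by rewrite -xe -(prefix_div x N L) -divn_eq.
  have pj : prefix x j = (prefix x N * b ^ (L - c) + d)%N.
    rewrite -(prefix_div x j c) (_ : (j + c = N + L)%N); last by rewrite /c; lia.
    rewrite pe (_ : b ^ L = b ^ (L - c) * b ^ c)%N; last first.
      by rewrite -expnD subnK // /c; lia.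
    by rewrite mulnA -mulnDl mulnK ?expn_gt0 ?b0.
  have xd : x j = d.
    apply/val_inj; rewrite /= -prefix_mod; last by lia.
    rewrite pj (_ : (L - c = (L - c).-1.+1)%N); last by rewrite /c; lia.
    by rewrite expnSr mulnA modnMDl modn_small.
  have := xD j (leq_ltn_trans (leq0n _) jN) nSj.
  by rewrite xd (negbTE dD).
- by rewrite -(prefix_div x N L) -divn_eq /N mulSn [(L + _)%N]addnC addnA.
Qed.

(** With [q = b ^ L], the count [(q - 1) ^ m] equals [(q ^ m) ^ alpha] for
    [alpha = ln (q - 1) / ln q], and [q ^ m] is comparable to the ratio of the
    radii when the b-adic levels [n] and [n + m * L] match them. *)
Lemma bounded_runs_dim_lt1 {R : realType} {b : nat} (D : {set 'I_b})
  (S : set nat) (L : nat) :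
  (2 <= b)%N -> D \proper [set: 'I_b]%SET ->
  (forall n, exists2 j, (n < j <= n + L)%N & ~ S j) ->
  (@assouad_dim R R^o (digit_set R S D) < 1)%E.
Proof.
move=> hb hD hL.
have L0 : (0 < L)%N by have [j] := hL 0%N; lia.
have bR : 1 < b%:R :> R by rewrite ltr1n.
have b0 : 0 < b%:R :> R by lra.
have pw n : 0 < b%:R ^- n :> R by rewrite invr_gt0 exprn_gt0.
have pwM n m : b%:R ^+ m * b%:R ^- (n + m) = b%:R ^- n :> R.
  by rewrite mulX_expN_add // gt_eqF.
pose q : R := b%:R ^+ L.
have q1 : 1 < q by rewrite exprn_egt1 // -lt0n.
have q0 : 0 < q by lra.
have q2 : 1 <= q - 1.
  rewrite lerBrDr /q -natrX -(natrD _ 1 1) ler_nat.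
  by apply: leq_trans (ltn_expl L hb).
have qE : ((b ^ L).-1)%:R = q - 1.
  by rewrite -subn1 natrB ?expn_gt0 ?natrX //; lia.
pose alpha := ln (q - 1) / ln q.
have lnq : 0 < ln q by apply: ln_gt0.
have a0 : 0 <= alpha by rewrite divr_ge0 ?ln_ge0 // ltW.
have a1 : alpha < 1.
  by rewrite ltr_pdivrMr // mul1r ltr_ln ?posrE //; lra.
have aE : q `^ alpha = q - 1.
  by rewrite /powR gt_eqF // divfK ?gt_eqF // lnK // posrE; lra.
apply: (@le_lt_trans _ _ alpha%:E); last by rewrite lte_fin.
apply: ereal_inf_lbound; exists alpha => //=; split => //.
(* The constant: a ball of radius at most b^-n meets at most three intervals of
   level n, and rounding both radii to b-adic scales costs a factor q * b. *)
exists 1, (3 * (q * b%:R) `^ alpha); split => //; split.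
  by rewrite mulr_gt0 // powR_gt0 // mulr_gt0.
move=> r r' r0 rr' r'1; have r'0 : 0 < r' by apply: lt_trans rr'.
apply: ge_ereal_sup => _ [x [X XD <-] <-]; rewrite -/(expansion R X).
(* n is chosen with b^-(n + 1) < r' <= b^-n. *)
have exn := geometric_below b r' hb r'0.
case: (ex_minnP exn) => n1 hn1 minn1.
have n10 : (0 < n1)%N by case: n1 hn1 {minn1} => //; rewrite expr0 invr1; lra.
set n := n1.-1; have n1E : n1 = n.+1 by rewrite prednK.
have r'n : r' <= b%:R ^- n.
  by rewrite leNgt; apply/negP => /minn1; rewrite n1E ltnn.
have nr' : b%:R ^- n < b%:R * r'.
  by rewrite -(pwM n 1%N) expr1 ltr_pM2l // addn1 -n1E.
(* m1 is least with b^-(n + m1 * L) < r, so its predecessor m gives the upper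
   bound on q ^ m1. *)
have exm : exists m, b%:R ^- (n + m * L) < r.
  have [N hN] := geometric_below b r hb r0; exists N; apply: le_lt_trans hN.
  rewrite lef_pV2 ?posrE ?exprn_gt0 // ler_weXn2l ?(ltW bR) //.
  by apply: leq_trans (leq_addl n _); rewrite leq_pmulr.
case: (ex_minnP exm) => m1 hm1 minm1.
have m10 : (0 < m1)%N.
  by case: m1 hm1 {minm1} => //; rewrite mul0n addn0; lra.
set m := m1.-1; have m1E : m1 = m.+1 by rewrite prednK.
have rm : r <= b%:R ^- (n + m * L).
  by rewrite leNgt; apply/negP => /minm1; rewrite m1E ltnn.
have qm : q ^+ m <= b%:R * (r' / r).
  rewrite mulrA ler_pdivlMr //; apply: le_trans (ltW nr').
  rewrite -(pwM n (m * L)%N) /q -exprM [(L * m)%N]mulnC.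
  by rewrite ler_pM2l ?exprn_gt0.
set N := (n + m1 * L)%N in hm1.
have [s0 ss0 hs0] := descendant_cells D S L n m1 (prefix X n).-1 hD hL.
have [s1 ss1 hs1] := descendant_cells D S L n m1 (prefix X n) hD hL.
have [s2 ss2 hs2] := descendant_cells D S L n m1 (prefix X n).+1 hD hL.
pose s := [seq k%:R * b%:R ^- N : R | k <- s0 ++ s1 ++ s2].
apply: (@le_trans _ _ ((size s)%:R%:E)).
  apply: covering_number_le => y [] /= + [Y YD Yy].
  rewrite -ball_normE /= -Yy -/(expansion R Y) => XY.
  exists ((prefix Y N)%:R * b%:R ^- N).
    apply/mapP; exists (prefix Y N) => //; rewrite !mem_cat.
    have := expansion_ge (R := R) X n; have := expansion_le (R := R) X n.
    have := expansion_ge (R := R) Y n; have := expansion_le (R := R) Y n.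
    move: XY; rewrite ltr_norml => /andP[d1 d2] Yle Yge Xle Xge.
    have YX : (prefix Y n < (prefix X n).+2)%N.
      rewrite -(ltr_nat R) -(ltr_pM2r (pw n)) -[(_.+2)]addn1 natrD mulrDl.
      by lra.
    have XY : (prefix X n < (prefix Y n).+2)%N.
      rewrite -(ltr_nat R) -(ltr_pM2r (pw n)) -[(_.+2)]addn1 natrD mulrDl.
      by lra.
    have [e0|[e1|e2]] : prefix Y n = (prefix X n).-1 \/
        prefix Y n = prefix X n \/ prefix Y n = (prefix X n).+1.
      by move: YX XY; clear; lia.
    - by rewrite hs0.
    - by rewrite hs1 ?orbT.
    - by rewrite hs2 ?orbT.
  have := expansion_ge (R := R) Y N; have := expansion_le (R := R) Y N.
  rewrite -[(_.+1)]addn1 natrD mulrDl mul1r => h1 h2.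
  by rewrite ltr_norml; lra.
have -> : (3 * (q * b%:R) `^ alpha * (r' / r) `^ alpha)%:E =
          (3 * (q * (b%:R * (r' / r))) `^ alpha)%:E :> \bar R.
  rewrite -[in LHS]mulrA -powRM.
  - by rewrite -[q * b%:R * _]mulrA.
  - by rewrite mulr_ge0 // ltW.
  - by rewrite divr_ge0 // ltW.
rewrite lee_fin; apply: (@le_trans _ _ (3 * (q - 1) ^+ m1)).
  rewrite -qE -natrX -natrM ler_nat size_map !size_cat.
  by move: ss0 ss1 ss2; clear; lia.
rewrite ler_pM2l // -aE -powR_mulrn ?powR_ge0 // -powRrM mulrC powRrM.
rewrite powR_mulrn ?(ltW q0) //; apply: ge0_ler_powR => //.
- by rewrite nnegrE exprn_ge0 // ltW.
- by rewrite nnegrE !mulr_ge0 ?invr_ge0 ?ltW.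
- by rewrite m1E exprS ler_pM2l.
Qed.

Theorem theorem2p1 (R : realType) (b : nat) (D : {set 'I_b}) (S : set nat)
  (hb : (2 <= b)%N)
  (hD0 : D != finset.set0) (hDT : D \proper [set: 'I_b]%SET)
  (hS1 : forall n : nat, S n -> (1 <= n)%N) (hS : infinite_set S) :
  contains_arbitrarily_long_APs (digit_set R S D) <->
  @assouad_dim R R^o (digit_set R S D) = 1%E.
Proof.
split=> [/(AP_long_runs D S hb hDT) runs|dim1].
  apply/eqP; rewrite eq_le assouad_dim_line_le1.
  exact: long_runs_dim_ge1.
apply: long_runs_AP => //; apply: contrapT => /bounded_runs[L hL].
have := bounded_runs_dim_lt1 (R := R) D S L hb hDT hL.
by rewrite dim1 ltxx.
Qed.
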